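(* Let $L$ be an integral domain, let $K\subset L$ be an infinite subring, and let $\hat{L}$, $\hat{K}$ be the fields of fractions of $L$ and $K$. Let $\underline{\mathrm{Num}}_{L/K}$, $\Gamma_L$, $\mathrm{ev}_{L/K}$ and $\mathrm{ev}^*_{L/K}$ be as defined in the context. The following conditions are equivalent. (1) There exist no nontrivial numerical functionals, i.e. $\underline{\mathrm{Num}}_{L/K}=L[K]$ (as submodules of $\hat{L}[K]$). (2) The map $\mathrm{ev}^*_{L/K}:L[K]\to\Gamma_L$ is an asymptotically split monomorphism (equivalently, the map $\mathrm{ev}_{L/K}:L[x]\to \mathrm{Map}(K,L)$ has a dense image). (3) The ring $L$ contains $\hat{K}$, i.e. every nonzero element of $K$ is invertible in $L$.
   Context: $L[K]$ denotes the free $L$-module on the set $K$, with basis vectors $[k]$, $k\in K$; similarly $\hat L[K]$ is the free $\hat L$-module on $K$, and $L[K]\subset\hat L[K]$. $\mathrm{Map}(K,L)$ is the $L$-module of all functions $K\to L$, with the $L$-linear topology in which a fundamental system of neighborhoods of $0$ is given by the submodules $\{g: g(k)=0 \text{ for all } k\in X\}$, with $X$ running over finite subsets of $K$. The evaluation map $\mathrm{ev}_{L/K}:L[x]\to\mathrm{Map}(K,L)$ sends a polynomial $p$ to the function $k\mapsto p(k)$. $\Gamma_L:=\mathrm{Hom}_L(L[x],L)\cong \mathrm{Hom}_K(K[x],L)$, with the linear topology in which a fundamental system of neighborhoods of $0$ is given by the annihilators $\{l: l(v)=0\text{ for all }v\in U\}$ of free finite rank $L$-submodules $U\subset L[x]$.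 It has the topological basis $u_n$, $n\ge 0$, where $u_n(x^k)=\delta_{nk}$. The dual evaluation map $\mathrm{ev}^*_{L/K}:L[K]\to\Gamma_L$ is the $L$-linear map with $\mathrm{ev}^*_{L/K}([k])(p)=p(k)$, i.e. $[k]\mapsto\sum_{i\ge0}k^iu_i$. The same formula defines an $\hat L$-linear map $\mathrm{ev}^*_{\hat L/K}:\hat L[K]\to\Gamma_{\hat L}:=\mathrm{Hom}_K(K[x],\hat L)$. The module of numerical functionals $\underline{\mathrm{Num}}_{L/K}$ is the pullback of $\mathrm{ev}^*_{\hat L/K}:\hat L[K]\to \mathrm{Hom}_K(K[x],\hat L)$ along the inclusion $\mathrm{Hom}_K(K[x],L)\to \mathrm{Hom}_K(K[x],\hat L)$; that is, $\underline{\mathrm{Num}}_{L/K}$ consists of those $\sum_i\alpha_i[k_i]\in\hat L[K]$ such that $\sum_i\alpha_ik_i^m\in L$ for all $m\ge0$. For a free $L$-module $V$, a submodule $U\subset V$ is admissible if $U$ is free of finite rank and is a direct summand of $V$ as an $L$-module. For $V$ a free $L$-module and $W$ an $L$-module with an $L$-linear topology, an $L$-module homomorphism $\phi:V\to W$ is an asymptotically split monomorphism (is asymptotically split) if for every admissible $U\subset V$ the composition $U\hookrightarrow V\to W$ has a continuous left inverse $L$-module homomorphism $W\to U$ ($U$ being discrete). *)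

(* Defs.v *)
From HB Require Import structures.
From mathcomp Require Import all_boot all_algebra.
From mathcomp Require Import all_classical.
From mathcomp Require Import topology.
From mathcomp.multinomials Require Import freeg.

Set Implicit Arguments.
Unset Strict Implicit.
Unset Printing Implicit Defensive.

Import GRing.Theory.

Local Open Scope classical_set_scope.
Local Open Scope ring_scope.

Section Submodules.
Context (R : nzRingType) (V : lmodType R).
Implicit Type U : set V.

Definition submodule U := submod_closed (mem U).

Lemma submoduleP U :
  submodule U <-> U 0 /\ forall a u v, U u -> U v -> U (a *: u + v).
Proof.
split=> [[U0 Ulin]|[U0 Ulin]].
  split; first exact: set_mem U0.
  by move=> a u v /mem_set Uu /mem_set Uv; apply/set_mem/(Ulin a).
split; first exact: mem_set U0.
by move=> a u v /set_mem Uu /set_mem Uv; apply/mem_set/Ulin.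
Qed.

Lemma submoduleB U u v : submodule U -> U u -> U v -> U (u - v).
Proof.
move=> /submoduleP[_ Ulin] Uu Uv.
by rewrite addrC -scaleN1r; exact: Ulin.
Qed.

Lemma submoduleD U u v : submodule U -> U u -> U v -> U (u + v).
Proof.
by move=> /submoduleP[_ Ulin] Uu Uv; rewrite -[u]scale1r; exact: Ulin.
Qed.

Definition free_finrank U :=
  exists (n : nat) (f : {linear 'rV[R]_n -> V}), injective f /\ range f = U.

Definition direct_summand U :=
  exists U' : set V, [/\ submodule U',
    forall v, exists u u', [/\ U u, U' u' & v = u + u']
    & U `&` U' = [set 0]].

Definition admissible U :=
  [/\ submodule U, free_finrank U & direct_summand U].

End Submodules.

(* A topology on a module is linear when it is translation invariant and the
   open submodules form a fundamental system of neighborhoods of 0. *)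
HB.mixin Record isLinearTopology (R : nzRingType) W
    & Topological W & GRing.Lmodule R W := {
  nbhs_linear : forall x : W, nbhs x =
    filter_from [set N : set W | submodule N /\ nbhs (0 : W) N]
                (fun N => [set y | N (y - x)])
}.

#[short(type="linearTopModType")]
HB.structure Definition LinearTopModule (R : nzRingType) :=
  {W of Topological W & GRing.Lmodule R W & isLinearTopology R W}.

(* The linear topology in which a given family of submodules is a fundamental
   system of neighborhoods of 0. *)
HB.factory Record hasSubmoduleBase (R : nzRingType) W & GRing.Lmodule R W := {
  submod_base : set (set W);
  submod_base_submodule : forall N, submod_base N -> submodule N;
  submod_base_neq0 : submod_base !=set0;
  submod_base_filter : forall N1 N2, submod_base N1 -> submod_base N2 ->
    exists2 N, submod_base N & N `<=` N1 `&` N2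
}.

HB.builders Context R W & hasSubmoduleBase R W.

Definition nbhs_of_base (x : W) : set_system W :=
  filter_from submod_base (fun N => [set y | N (y - x)]).

HB.instance Definition _ := hasNbhs.Build W nbhs_of_base.

Fact nbhs_of_base_filter (x : W) : ProperFilter (nbhs x).
Proof.
apply: filter_from_proper; last first.
  move=> N /submod_base_submodule/submoduleP[N0 _].
  by exists x; rewrite /= subrr.
apply: filter_from_filter; first exact: submod_base_neq0.
move=> N1 N2 bN1 bN2; have [N bN sN] := submod_base_filter bN1 bN2.
by exists N => // y /sN.
Qed.

Fact nbhs_of_base_singleton (x : W) (A : set W) : nbhs x A -> A x.
Proof.
case=> N /submod_base_submodule/submoduleP[N0 _]; apply.
by rewrite /= subrr.
Qed.

Fact nbhs_of_base_nbhs (x : W) (A : set W) : nbhs x A -> nbhs x (nbhs^~ A).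
Proof.
case=> N bN sNA; exists N => // y /= Ny; exists N => // z /= Nz.
apply: sNA => /=; have -> : z - x = (z - y) + (y - x) by rewrite addrA subrK.
exact: submoduleD (submod_base_submodule bN) Nz Ny.
Qed.

HB.instance Definition _ := Nbhs_isNbhsTopological.Build W
  nbhs_of_base_filter nbhs_of_base_singleton nbhs_of_base_nbhs.

Fact nbhs_of_base_linear (x : W) : nbhs x =
  filter_from [set N : set W | submodule N /\ nbhs (0 : W) N]
              (fun N => [set y | N (y - x)]).
Proof.
apply/seteqP; split=> A.
  case=> N bN sNA; exists N => //; split; first exact: submod_base_submodule.
  by exists N => // y /=; rewrite subr0.
case=> N [sN [M bM sMN]] sNA; exists M => // y /= My; apply: sNA => /=.
by apply: sMN; rewrite /= subr0.
Qed.

HB.instance Definition _ := isLinearTopology.Build R W nbhs_of_base_linear.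

HB.end.

(* The submodule U carries the discrete topology. A left inverse W -> U is
   represented by a linear map psi : W -> V with values in U; the discrete
   topology of V induces the one of U. *)
Definition asymptotically_split (R : nzRingType) (V : lmodType R)
    (W : linearTopModType R) (phi : {linear V -> W}) :=
  forall U : set V, admissible U ->
    exists psi : {linear W -> V},
      [/\ forall w, U (psi w),
          forall u, U u -> psi (phi u) = u
        & continuous (psi : W -> discrete_topology V)].

Section Map.
Context (K : Type) (L : comNzRingType).

Definition Map := K -> L^o.

HB.instance Definition _ := GRing.Lmodule.on Map.

Definition vanishing_on (X : set K) : set Map :=
  [set g | forall k, X k -> g k = 0].

Let base : set (set Map) :=
  [set N | exists2 X : set K, finite_set X & N = vanishing_on X].

Let base_submodule N : base N -> submodule N.
Proof.
case=> X _ ->; apply/submoduleP; split=> [k _ //|a u v u0 v0 k Xk].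
rewrite [LHS](_ : _ = a * u k + v k) //.
by rewrite (u0 _ Xk) (v0 _ Xk) mulr0 addr0.
Qed.

Let base_neq0 : base !=set0.
Proof. by exists (vanishing_on set0), set0. Qed.

Let base_filter N1 N2 : base N1 -> base N2 ->
  exists2 N, base N & N `<=` N1 `&` N2.
Proof.
case=> X1 fX1 -> [X2 fX2 ->]; exists (vanishing_on (X1 `|` X2)).
  by exists (X1 `|` X2) => //; rewrite finite_setU.
by move=> g g0; split=> k Xk; apply: g0; [left|right].
Qed.

HB.instance Definition _ :=
  hasSubmoduleBase.Build L Map base_submodule base_neq0 base_filter.

Lemma nbhs_MapE (g : Map) : nbhs g =
  [set A | exists2 X : set K, finite_set X &
     [set h | vanishing_on X (h - g)] `<=` A].
Proof.
apply/seteqP; split=> A; first by case=> _ [X fX ->] sA; exists X.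
by case=> X fX sA; exists (vanishing_on X) => //; exists X.
Qed.

End Map.

Section Gamma.
Context (L : comNzRingType).

Definition Gamma := {scalar {poly L}}.

HB.instance Definition _ := gen_eqMixin Gamma.
HB.instance Definition _ := gen_choiceMixin Gamma.

Implicit Types f g h : Gamma.

Lemma Gamma_eq f g : (forall p, f p = g p) -> f = g.
Proof.
case: f g => [f [[fA] [fZ]]] [g [[gA] [gZ]]] /= /funext fg; subst g.
by rewrite (Prop_irrelevance fA gA) (Prop_irrelevance fZ gZ).
Qed.

Let Gamma0 : Gamma := \0.
Let Gamma_add f g : Gamma := f \+ g.
Let Gamma_opp f : Gamma := \- f.

(* \*o is registered in ssralg as linear for *:%R only, not for *%R. *)
Definition Gamma_scale_fun (a : L) f (p : {poly L}) : L := a * f p.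

Fact Gamma_scale_fun_is_scalar a f : scalar (Gamma_scale_fun a f).
Proof.
by move=> b p q; rewrite /Gamma_scale_fun linearP mulrDr mulrCA.
Qed.

HB.instance Definition _ a f :=
  GRing.isLinear.Build L {poly L} L *%R (Gamma_scale_fun a f)
    (Gamma_scale_fun_is_scalar a f).

Let Gamma_scale (a : L) f : Gamma := Gamma_scale_fun a f.

Let addA : associative Gamma_add.
Proof. by move=> f g h; apply: Gamma_eq => p /=; rewrite addrA. Qed.
Let addC : commutative Gamma_add.
Proof. by move=> f g; apply: Gamma_eq => p /=; rewrite addrC. Qed.
Let add0 : left_id Gamma0 Gamma_add.
Proof. by move=> f; apply: Gamma_eq => p /=; rewrite add0r. Qed.
Let addN : left_inverse Gamma0 Gamma_opp Gamma_add.
Proof. by move=> f; apply: Gamma_eq => p /=; rewrite addNr. Qed.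

HB.instance Definition _ := GRing.isZmodule.Build Gamma addA addC add0 addN.

Let scaleA a b f : Gamma_scale a (Gamma_scale b f) = Gamma_scale (a * b) f.
Proof. by apply: Gamma_eq => p; rewrite /= /Gamma_scale_fun mulrA. Qed.
Let scale1 : left_id 1 Gamma_scale.
Proof. by move=> f; apply: Gamma_eq => p; rewrite /= /Gamma_scale_fun mul1r. Qed.
Let scaleDr : right_distributive Gamma_scale +%R.
Proof. by move=> a f g; apply: Gamma_eq => p; rewrite /= /Gamma_scale_fun mulrDr. Qed.
Let scaleDl f : {morph Gamma_scale^~ f : a b / a + b}.
Proof. by move=> a b; apply: Gamma_eq => p; rewrite /= /Gamma_scale_fun mulrDl. Qed.

HB.instance Definition _ :=
  GRing.Zmodule_isLmodule.Build L Gamma scaleA scale1 scaleDr scaleDl.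

Definition annihilator (U : set {poly L}) : set Gamma :=
  [set l : Gamma | forall v, U v -> l v = 0].

Let base : set (set Gamma) :=
  [set N | exists2 U : set {poly L}, free_finrank U & N = annihilator U].

Let base_submodule N : base N -> submodule N.
Proof.
case=> U _ ->; apply/submoduleP; split=> [v _ //|a f g f0 g0 v Uv].
rewrite [LHS](_ : _ = a * f v + g v) //.
by rewrite (f0 _ Uv) (g0 _ Uv) mulr0 addr0.
Qed.

Let free_finrank_rVpoly n : free_finrank (range (@rVpoly L n)).
Proof. by exists n, (@rVpoly L n); split=> //; exact: can_inj (@rVpolyK _ n). Qed.

Let free_finrank_bounded U : free_finrank U ->
  exists n, forall m, (n <= m)%N -> U `<=` range (@rVpoly L m).
Proof.
case=> d [f [_ <-]]; exists (\max_(i < d) size (f (delta_mx 0%R i)))%N.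
move=> m le_m _ [x _ <-]; exists (poly_rV (f x)) => //.
apply: poly_rV_K; rewrite [x]row_sum_delta linear_sum /=.
apply: (leq_trans (size_sum _ _ _)); apply/bigmax_leqP => i _.
rewrite linearZ /=; apply: leq_trans (size_scale_leq _ _) _.
exact: leq_trans (leq_bigmax i) le_m.
Qed.

Let base_neq0 : base !=set0.
Proof.
exists (annihilator (range (@rVpoly L 0))), (range (@rVpoly L 0)) => //.
Qed.

Let base_filter N1 N2 : base N1 -> base N2 ->
  exists2 N, base N & N `<=` N1 `&` N2.
Proof.
case=> U1 /free_finrank_bounded[n1 s1] -> [U2 /free_finrank_bounded[n2 s2] ->].
pose n := maxn n1 n2; exists (annihilator (range (@rVpoly L n))).
  by exists (range (@rVpoly L n)).
move=> l l0; split=> v Uv; apply: l0.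
  by apply: s1 Uv; rewrite leq_maxl.
by apply: s2 Uv; rewrite leq_maxr.
Qed.

HB.instance Definition _ :=
  hasSubmoduleBase.Build L Gamma base_submodule base_neq0 base_filter.

Lemma nbhs_GammaE (l : Gamma) : nbhs l =
  [set A | exists2 U : set {poly L}, free_finrank U &
     [set l' | annihilator U (l' - l)] `<=` A].
Proof.
apply/seteqP; split=> A; first by case=> _ [U fU ->] sA; exists U.
by case=> U fU sA; exists (annihilator U) => //; exists U.
Qed.

Definition Gamma_eval (x : L) : Gamma := horner_eval x.

End Gamma.

Section FreegLift.
Context (R : nzRingType) (M : lmodType R) (K : choiceType) (f : K -> M).

Lemma fglift_sumE (D : {freeg K / R}) :
  fglift f D = \sum_(k <- dom D) coeff k D *: f k.
Proof.
by rewrite -{1}[D]Freeg_dom fglift_Freeg /prelift big_map.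
Qed.

Fact fglift_is_linear : linear (fglift f).
Proof.
move=> a D1 D2.
have DE (D : {freeg K / R}) (s : seq K) : uniq s -> {subset dom D <= s} ->
    fglift f D = \sum_(k <- s) coeff k D *: f k.
  move=> us sD; rewrite fglift_sumE [RHS](bigID (mem (dom D))) /=.
  rewrite [X in _ + X]big1 ?addr0 => [|k kD]; last first.
    by rewrite coeff_outdom // scale0r.
  rewrite -[in RHS]big_filter; apply/perm_big/uniq_perm; rewrite ?filter_uniq //.
    exact: uniq_dom.
  by move=> k; rewrite mem_filter andb_idr //= => /sD.
pose s := undup (dom D1 ++ dom D2).
have us : uniq s by exact: undup_uniq.
rewrite !(DE _ s) //.
- rewrite scaler_sumr -big_split /=; apply: eq_bigr => k _.
  by rewrite coeffD coeffZ scalerDl scalerA.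
- by move=> k kD; rewrite mem_undup mem_cat kD orbT.
- by move=> k kD; rewrite mem_undup mem_cat kD.
- move=> k /domD_subset; rewrite mem_undup !mem_cat.
  by case/orP=> [/domZ_subset|] ->; rewrite ?orbT.
Qed.

HB.instance Definition _ :=
  GRing.isLinear.Build R {freeg K / R} M *:%R (fglift f) fglift_is_linear.

End FreegLift.

Section NumericalFunctionals.
Context (L : idomainType) (S : pred L) (K : subComNzRingType S).

Local Notation Lhat := {fraction L}.

Definition ev (p : {poly L}) : Map K L := fun k => p.[val k].

Definition ev_dual : {linear {freeg K / L} -> Gamma L} :=
  fglift (fun k : K => Gamma_eval (val k)).

Lemma ev_dualU (k : K) (p : {poly L}) :
  (ev_dual << k >> : Gamma L) p = p.[val k].
Proof. by rewrite [ev_dual _](liftU (fun k : K => Gamma_eval (val k))) scale1r. Qed.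

(* Hom_K(K[x], B) for a K-algebra B with structure map j. *)
Definition HomK (B : comNzRingType) (j : {rmorphism K -> B}) :=
  {linear {poly K} -> B | j \; *%R}.

Definition K_to_L : {rmorphism K -> L} := \val.
Definition K_to_Lhat : {rmorphism K -> Lhat} := @tofrac L \o K_to_L.

Definition ev_dual_hat_fun (alpha : {freeg K / Lhat}) (p : {poly K}) : Lhat :=
  \sum_(k <- dom alpha) coeff k alpha * K_to_Lhat p.[k].

Fact ev_dual_hat_is_linear (alpha : {freeg K / Lhat}) :
  linear_for (K_to_Lhat \; *%R) (ev_dual_hat_fun alpha).
Proof.
move=> a p q; rewrite /ev_dual_hat_fun -[RHS]/(K_to_Lhat a * _ + _).
rewrite mulr_sumr -big_split; apply: eq_bigr => k _.
by rewrite hornerD hornerZ rmorphD rmorphM mulrDr (mulrCA _ (K_to_Lhat a)).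
Qed.

HB.instance Definition _ (alpha : {freeg K / Lhat}) :=
  GRing.isLinear.Build K {poly K} Lhat (K_to_Lhat \; *%R)
    (ev_dual_hat_fun alpha) (ev_dual_hat_is_linear alpha).

Definition ev_dual_hat (alpha : {freeg K / Lhat}) : HomK K_to_Lhat :=
  ev_dual_hat_fun alpha.

Definition freeg_frac (D : {freeg K / L}) : {freeg K / Lhat} :=
  \sum_(k <- dom D) << tofrac (coeff k D) *g k >>.

Lemma coeff_freeg_frac (D : {freeg K / L}) k :
  coeff k (freeg_frac D) = tofrac (coeff k D).
Proof.
rewrite -[in RHS](freeg_sumE D) /freeg_frac !raddf_sum /=.
by apply: eq_bigr => k' _; rewrite !coeffU rmorphM rmorph_nat.
Qed.

(* The pullback of ev_dual_hat along Hom_K(K[x], L) -> Hom_K(K[x], Lhat). *)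
Definition num_functionals : set {freeg K / Lhat} :=
  [set alpha | exists l : HomK K_to_L,
     forall p, ev_dual_hat alpha p = tofrac (l p)].

Lemma num_functionalsP alpha :
  num_functionals alpha <-> forall m : nat, exists x : L,
    \sum_(k <- dom alpha) coeff k alpha * tofrac (val k ^+ m) = tofrac x.
Proof.
have evXn m : ev_dual_hat alpha 'X^m =
    \sum_(k <- dom alpha) coeff k alpha * tofrac (val k ^+ m).
  by apply: eq_bigr => k _; rewrite hornerXn /= rmorphXn.
split=> [[l lE] m|/choice[u uE]]; first by exists (l 'X^m); rewrite -lE.
pose l (p : {poly K}) : L := \sum_(i < size p) val p`_i * u i.
have lE p : ev_dual_hat alpha p = tofrac (l p).
  rewrite -{1}[p]coefK poly_def linear_sum rmorph_sum.
  apply: eq_bigr => i _; rewrite linearZ evXn uE.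
  by rewrite rmorphM.
have l_lin : linear_for (K_to_L \; *%R) l.
  move=> a p q; apply/eqP; rewrite -tofrac_eq -lE linearP /= rmorphD rmorphM /=.
  by rewrite -!lE.
pose L_ := GRing.isLinear.Build K {poly K} L (K_to_L \; *%R) l l_lin.
pose lH : HomK K_to_L := HB.pack l L_.
by exists lH.
Qed.

(* The field of fractions of K, as a subfield of Lhat. *)
Definition Khat : set Lhat :=
  [set x | exists a b : K, b != 0 /\ x = tofrac (val a) / tofrac (val b)].

End NumericalFunctionals.

Arguments ev {L S} K.
Arguments ev_dual {L S} K.
Arguments freeg_frac {L S} K.
Arguments num_functionals {L S} K.
Arguments Khat {L S} K.

(* Main.v *)
Require Import Defs.
From HB Require Import structures.
From mathcomp Require Import all_boot all_algebra.
From mathcomp Require Import all_classical.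
From mathcomp Require Import topology.
From mathcomp.multinomials Require Import freeg.

Set Implicit Arguments.
Unset Strict Implicit.
Unset Printing Implicit Defensive.

Import GRing.Theory.

Local Open Scope classical_set_scope.
Local Open Scope ring_scope.

(** Everything is compared with the invertibility in [L] of the nonzero
    elements of [K].

    If these are invertible, then the differences of distinct points of [K]
    are invertible in [L], so the Lagrange basis polynomials of any finite set
    of nodes in [K] have coefficients in [L] ([lagrange_eval]). They interpolate
    any function on the nodes, which is density ([dense_ev]); evaluating a
    functional on them recovers the coefficients of a combination of nodes,
    which gives the continuous left inverses ([asymptotically_split_ev_dual])
    and shows that the coefficients of a numerical functional lie in [L]
    ([num_functionals_trivial]).

    Conversely, fix [k != 0] in [K]. For every polynomial [p] the value
    [p(k) - p(0)] is [k] times the value at [k] of the quotient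
    [(p - p(0)) / 'X], so [k] divides the image of [[k] - [0]] in [Gamma L].
    Each of the first three conditions then makes [k] a unit: the element
    [([k] - [0]) / k] is a numerical functional with coefficient [1 / k]
    ([num_functionals_unit]); a left inverse of the dual evaluation on the line
    of [[k] - [0]] makes this basis vector divisible by [k]
    ([asymptotically_split_unit]); and a polynomial that takes the values 0 at
    0 and 1 at [k] makes 1 divisible by [k] ([dense_ev_unit]). That [L] contains
    the fraction field of [K] is a rewording of the invertibility. *)

(** * Lagrange interpolation *)

Definition lagrange (L : idomainType) (S : pred L) (K : subComNzRingType S)
    (s : seq K) (j : K) : {poly L} :=
  \prod_(i <- s | i != j) ((val j - val i)^-1 *: ('X - (val i)%:P)).

Lemma lagrange_eval (L : idomainType) (S : pred L) (K : subComNzRingType S)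
    (s : seq K) (j k : K) :
  (forall k : K, k != 0 -> val k \is a GRing.unit) ->
  k \in s -> (lagrange s j).[val k] = (k == j)%:R.
Proof.
move=> Kunit ks; rewrite /lagrange horner_prod.
have [->|kj] := eqVneq k j.
  rewrite big1 // => i ij; rewrite hornerZ hornerXsubC -rmorphB mulVr //.
  by apply: Kunit; rewrite subr_eq0 eq_sym.
rewrite big_mkcond (big_rem k) //= kj hornerZ hornerXsubC subrr mulr0.
by rewrite mul0r.
Qed.

Lemma big_seq_delta (R : pzSemiRingType) (K : eqType) (s : seq K) (j : K)
    (F : K -> R) :
  uniq s -> j \in s -> \sum_(k <- s) F k * (k == j)%:R = F j.
Proof.
move=> us js; rewrite (bigD1_seq j) //= eqxx mulr1 big1 ?addr0 // => k kj.
by rewrite (negPf kj) mulr0.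
Qed.

(** * Invertibility implies the other conditions *)

Lemma dense_ev (L : idomainType) (S : pred L) (K : subComNzRingType S) :
  (forall k : K, k != 0 -> val k \is a GRing.unit) -> dense (range (ev K)).
Proof.
move=> Kunit O [g Og] oO.
have: nbhs g O by exact: open_nbhs_nbhs.
rewrite nbhs_MapE => -[X /finite_seqP[s ->] sO].
pose t := undup s; pose p := \sum_(j <- t) g j *: lagrange t j.
exists (ev K p); split; last by exists p.
apply: sO => k /= ks; apply/eqP; rewrite subr_eq0; apply/eqP.
have kt : k \in t by rewrite mem_undup.
rewrite /ev /p horner_sum -[RHS](big_seq_delta g (undup_uniq s) kt).
by apply: eq_bigr => j _; rewrite hornerZ (lagrange_eval _ Kunit) // eq_sym.
Qed.

(** Components along a direct sum decomposition are unique, so choosing them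
    pointwise gives a linear map. *)
Lemma direct_summand_projection (R : nzRingType) (V : lmodType R) (U : set V) :
  submodule U -> direct_summand U ->
  exists pi : {linear V -> V},
    (forall v, U (pi v)) /\ (forall u, U u -> pi u = u).
Proof.
move=> sU [U' [sU' UU' U0]].
have /choice[pi piP] v : exists u, U u /\ U' (v - u).
  by have [u [u' [Uu U'u' ->]]] := UU' v; exists u; rewrite addrAC subrr add0r.
have sub_eq u1 u2 : U u1 -> U u2 -> U' (u1 - u2) -> u1 = u2.
  move=> Uu1 Uu2 U'u; apply/eqP; rewrite -subr_eq0; apply/eqP.
  have : (U `&` U') (u1 - u2) by split=> //; exact: submoduleB.
  by rewrite U0.
have pi_lin : linear pi.
  move=> a v w; have [Uv U'v] := piP v; have [Uw U'w] := piP w.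
  have [Uvw U'vw] := piP (a *: v + w).
  have /submoduleP[_ Ulin] := sU; have /submoduleP[_ U'lin] := sU'.
  apply: sub_eq => //; first exact: Ulin.
  have -> : pi (a *: v + w) - (a *: pi v + pi w) =
      (a *: (v - pi v) + (w - pi w)) - (a *: v + w - pi (a *: v + w)).
    by rewrite scalerBr addrACA -opprD opprB [RHS]addrC subrKA.
  by apply: submoduleB => //; exact: U'lin.
pose pi_ := GRing.isLinear.Build R V V *:%R pi pi_lin.
pose piL : {linear V -> V} := HB.pack pi pi_.
exists piL; split=> [v|u Uu] /=; first by have [] := piP v.
have [Upu U'pu] := piP u.
by apply/esym/sub_eq.
Qed.

Lemma free_finrank_freeg_dom (R : nzRingType) (K : choiceType)
    (U : set {freeg K / R}) :
  free_finrank U -> exists s : seq K, forall D, U D -> {subset dom D <= s}.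
Proof.
move=> [n [f [_ <-]]].
exists (flatten [seq dom (f (delta_mx 0 i)) | i <- enum 'I_n]).
move=> _ [x _ <-] k; rewrite {1}[x]row_sum_delta linear_sum /=.
move=> /dom_sum_subset /flatten_mapP[i].
rewrite filter_predT => _; rewrite linearZ /= => /domZ_subset ki.
by apply/flatten_mapP; exists i => //; rewrite mem_enum.
Qed.

Lemma ev_dualE (L : idomainType) (S : pred L) (K : subComNzRingType S)
    (D : {freeg K / L}) (p : {poly L}) :
  (ev_dual K D : Gamma L) p = \sum_(k <- dom D) coeff k D * p.[val k].
Proof.
rewrite [ev_dual K D](fglift_sumE (fun k : K => Gamma_eval (val k))).
exact: (big_morph (fun l : Gamma L => l p)).
Qed.

Lemma lagrange_ev_dual (L : idomainType) (S : pred L) (K : subComNzRingType S)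
    (s : seq K) (D : {freeg K / L}) :
  (forall k : K, k != 0 -> val k \is a GRing.unit) ->
  uniq s -> {subset dom D <= s} ->
  \sum_(j <- s) (ev_dual K D : Gamma L) (lagrange s j) *: << j >> = D.
Proof.
move=> Kunit us sD; rewrite -[RHS]freeg_sumE.
transitivity (\sum_(j <- s) << coeff j D *g j >>).
  apply: eq_big_seq => j js; rewrite ev_dualE.
  apply/eqP/freeg_eqP => i; rewrite coeffZ !coeffU mul1r; congr (_ * _).
  rewrite [LHS](_ : _ = \sum_(k <- dom D) coeff k D * (k == j)%:R); last first.
    by apply: eq_big_seq => k /sD ks; rewrite (lagrange_eval _ Kunit).
  have [jD|jD] := boolP (j \in dom D); first exact/big_seq_delta/jD/uniq_dom.
  rewrite coeff_outdom // big_seq big1 // => k kD.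
  by rewrite (negPf (memPn jD _ kD)) mulr0.
rewrite (bigID (mem (dom D))) /= [X in _ + X]big1 ?addr0 => [|k kD]; last first.
  by rewrite coeff_outdom // freegU0.
rewrite -big_filter; apply/perm_big/uniq_perm; rewrite ?filter_uniq ?uniq_dom //.
by move=> k; rewrite mem_filter andb_idr //= => /sD.
Qed.

(** Evaluation at finitely many polynomials is continuous: these polynomials
    lie in the free module of polynomials of bounded degree. *)
Lemma Gamma_evaluation_continuous (L : comNzRingType) (T : choiceType)
    (I : eqType) (s : seq I) (P : I -> {poly L}) (F : Gamma L -> T) :
  (forall w w' : Gamma L, {in s, forall i, w (P i) = w' (P i)} -> F w = F w') ->
  continuous (F : Gamma L -> discrete_topology T).
Proof.
move=> Fdet w A /nbhs_singleton Aw.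
rewrite nbhs_GammaE; pose n := (\max_(i <- s) size (P i))%N.
exists (range (@rVpoly L n)).
  by exists n, (@rVpoly L n); split=> //; exact: can_inj (@rVpolyK _ n).
move=> w' /= w'w; rewrite /preimage /= (_ : F w' = F w) //.
apply: Fdet => i si; apply/eqP; rewrite -subr_eq0; apply/eqP.
apply: (w'w (P i)); exists (poly_rV (P i)) => //.
by apply: poly_rV_K; exact: leq_bigmax_seq.
Qed.

(** The left inverse reads off the coefficients at the nodes of a finite set
    supporting [U], and then projects onto [U]. *)
Lemma asymptotically_split_ev_dual (L : idomainType) (S : pred L)
    (K : subComNzRingType S) :
  (forall k : K, k != 0 -> val k \is a GRing.unit) ->
  asymptotically_split (ev_dual K).
Proof.
move=> Kunit U [sU /free_finrank_freeg_dom[s sdom] dU].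
have [pi [piU piK]] := direct_summand_projection sU dU.
pose t := undup s.
pose psi (w : Gamma L) := pi (\sum_(j <- t) w (lagrange t j) *: << j >>).
have psi_lin : linear psi.
  move=> a w w'; rewrite /psi -linearP; congr (pi _).
  rewrite scaler_sumr -big_split; apply: eq_bigr => j _ /=.
  by rewrite scalerA -scalerDl.
pose psi_ := GRing.isLinear.Build L (Gamma L) {freeg K / L} *:%R psi psi_lin.
pose psiL : {linear Gamma L -> {freeg K / L}} := HB.pack psi psi_.
exists psiL; split=> [w|D UD|]; first exact: piU.
  rewrite /= /psi lagrange_ev_dual ?undup_uniq ?piK // => k /(sdom _ UD).
  by rewrite mem_undup.
apply: (@Gamma_evaluation_continuous _ _ _ t (lagrange t)) => w w' ww' /=.
by congr (pi _); apply: eq_big_seq => j /ww' ->.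
Qed.

(** The moments of a numerical functional lie in [L], and the coefficient of a
    node is the combination of these moments whose coefficients are those of
    the Lagrange polynomial of this node. *)
Lemma num_functionals_trivial (L : idomainType) (S : pred L)
    (K : subComNzRingType S) :
  (forall k : K, k != 0 -> val k \is a GRing.unit) ->
  num_functionals K = range (freeg_frac K).
Proof.
move=> Kunit; apply/seteqP; split=> alpha; last first.
  move=> [D _ <-]; apply/num_functionalsP => m.
  exists (\sum_(k <- dom (freeg_frac K D)) coeff k D * val k ^+ m).
  rewrite rmorph_sum; apply: eq_bigr => k _.
  by rewrite coeff_freeg_frac rmorphM.
move=> /num_functionalsP/choice[u uE].
have coeffL k : exists c, coeff k alpha = tofrac c.
  have [kD|kD] := boolP (k \in dom alpha); last first.
    by exists 0; rewrite coeff_outdom // rmorph0.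
  pose p := lagrange (dom alpha) k; exists (\sum_(i < size p) p`_i * u i).
  rewrite rmorph_sum -(big_seq_delta (fun j => coeff j alpha) (uniq_dom alpha) kD).
  under [RHS]eq_bigr do rewrite rmorphM /= -uE mulr_sumr.
  rewrite exchange_big; apply: eq_big_seq => j jD.
  rewrite -[X in _ * X](rmorph_nat (@tofrac L)) -(lagrange_eval _ Kunit jD).
  rewrite horner_coef rmorph_sum mulr_sumr; apply: eq_bigr => i _.
  by rewrite rmorphM mulrCA.
have /choice[c cE] := coeffL.
exists (\sum_(k <- dom alpha) << c k *g k >>) => //.
apply/eqP/freeg_eqP => j; rewrite coeff_freeg_frac -[in RHS](freeg_sumE alpha).
rewrite !raddf_sum; apply: eq_bigr => k _ /=.
by rewrite !coeffU rmorphM rmorph_nat cE.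
Qed.

(** * Each condition implies invertibility *)

Lemma num_functionals_unit (L : idomainType) (S : pred L)
    (K : subComNzRingType S) :
  num_functionals K = range (freeg_frac K) ->
  forall k : K, k != 0 -> val k \is a GRing.unit.
Proof.
move=> numE k k0; pose x : {fraction L} := (tofrac (val k))^-1.
have vk0 : tofrac (val k) != 0 by rewrite tofrac_eq0 raddf_eq0 //; exact: val_inj.
pose alpha : {freeg K / {fraction L}} := << x *g k >> - << x *g 0 >>.
have : num_functionals K alpha.
  apply/num_functionalsP => m.
  (* The m-th moment is a linear function of alpha, so it can be computed
     termwise, whatever the support of alpha is. *)
  rewrite -(fglift_sumE (fun k => tofrac (val k ^+ m) : {fraction L}^o)).
  rewrite linearB /= !liftU rmorph0.
  case: m => [|m]; first by exists 0; rewrite !expr0 subrr rmorph0.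
  exists (val k ^+ m); rewrite expr0n rmorph0 scaler0 subr0 exprS rmorphM.
  by rewrite /GRing.scale /= mulrA mulVf // mul1r.
rewrite numE => -[D _ DE].
have : coeff k alpha = tofrac (coeff k D) by rewrite -DE coeff_freeg_frac.
rewrite coeffB !coeffU eqxx mulr1 eq_sym (negPf k0) mulr0 subr0 => xE.
apply/unitrPr; exists (coeff k D); apply/eqP; rewrite -tofrac_eq rmorphM /= -xE.
by rewrite divff // rmorph1.
Qed.

(** The kernel of [phi] is a complement of the line of [e]. *)
Lemma admissible_line (R : nzRingType) (V : lmodType R) (phi : V -> R) (e : V) :
  scalar phi -> phi e = 1 -> admissible (range (fun a : R => a *: e)).
Proof.
move=> phi_lin phi_e.
pose phi_ := GRing.isLinear.Build R V R *%R phi phi_lin.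
pose phiL : {scalar V} := HB.pack phi phi_.
have phiZ a : phiL (a *: e) = a by rewrite linearZ /= phi_e mulr1.
split.
- apply/submoduleP; split; first by exists 0; rewrite ?scale0r.
  by move=> a _ _ [b _ <-] [c _ <-]; exists (a * b + c); rewrite // scalerDl scalerA.
- pose f (v : 'rV[R]_1) := v 0 0 *: e.
  have f_lin : linear f.
    by move=> a v w; rewrite /f !mxE scalerDl scalerA.
  pose f_ := GRing.isLinear.Build R _ V *:%R f f_lin.
  pose fL : {linear 'rV[R]_1 -> V} := HB.pack f f_.
  exists 1%N, fL; split.
    move=> v w /(congr1 phiL); rewrite [fL v]/(v 0 0 *: e) [fL w]/(w 0 0 *: e).
    rewrite !phiZ => vw.
    by apply/matrixP => i j; rewrite !ord1.
  apply/seteqP; split=> _ [a _ <-]; first by exists (a 0 0).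
  by exists (const_mx a) => //=; rewrite /f mxE.
- exists [set v | phiL v = 0]; split.
  + apply/submoduleP; split=> [|a u v /= u0 v0]; first exact: linear0.
    by rewrite phi_lin u0 v0 mulr0 addr0.
  + move=> v; exists (phiL v *: e), (v - phiL v *: e); split; first by exists (phiL v).
    * by rewrite /mkset linearB phiZ subrr.
    * by rewrite addrC subrK.
  + apply/seteqP; split=> [_ [[a _ <-]]|_ ->] /=.
      by rewrite [phi _]phiZ => ->; rewrite scale0r.
    by split; [exists 0; rewrite ?scale0r | exact: (linear0 phiL)].
Qed.

(** Being linear, a left inverse of [f] on the line of [e] carries a
    factorization of [f e] by [a] back to one of [e], and [phi] turns that into
    a factorization of 1. *)
Lemma asymptotically_split_divisor (R : nzRingType) (V : lmodType R)
    (W : linearTopModType R) (f : {linear V -> W}) (phi : V -> R) (e : V)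
    (a : R) (w : W) :
  asymptotically_split f -> scalar phi -> phi e = 1 -> f e = a *: w ->
  exists b, a * b = 1.
Proof.
move=> f_split phi_lin phi_e fe.
have [psi [_ psiK _]] := f_split _ (admissible_line phi_lin phi_e).
pose phi_ := GRing.isLinear.Build R V R *%R phi phi_lin.
pose phiL : {scalar V} := HB.pack phi phi_.
exists (phi (psi w)); rewrite -phi_e -[in RHS](psiK e); last first.
  by exists 1; rewrite ?scale1r.
by rewrite fe linearZ -[RHS]/(phiL (a *: psi w)) linearZ.
Qed.

Lemma horner_sub_horner0 (R : comNzRingType) (p : {poly R}) (x : R) :
  p.[x] - p.[0] = x * (drop_poly 1 p).[x].
Proof.
have pE := poly_take_drop 1 p.
rewrite -{1 2}pE !hornerD !hornerM !hornerXn expr0n mulr0 addr0 expr1.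
have -> : take_poly 1 p = (p`_0)%:P.
  by apply/polyP => -[|i]; rewrite coef_take_poly coefC.
by rewrite !hornerC addrAC subrr add0r mulrC.
Qed.

(** This is [([x] - [0]) / x] without the division: by [horner_sub_horner0],
    [x] times it is the difference of the evaluations at [x] and at 0. *)
Definition divided_difference0 (R : comNzRingType) (x : R) : Gamma R :=
  horner_eval x \o drop_poly 1.

Lemma asymptotically_split_unit (L : idomainType) (S : pred L)
    (K : subComNzRingType S) :
  asymptotically_split (ev_dual K) ->
  forall k : K, k != 0 -> val k \is a GRing.unit.
Proof.
move=> K_split k k0.
pose e : {freeg K / L} := << k >> - << 0 >>.
apply/unitrPr.
apply: (asymptotically_split_divisor (phi := coeff k) (e := e)
  (w := divided_difference0 (val k)) K_split).
- by move=> a D1 D2; rewrite coeffD coeffZ.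
- by rewrite coeffB !coeffU eqxx eq_sym (negPf k0) mulr0 subr0 mulr1.
- apply: Gamma_eq => p; rewrite linearB.
  rewrite [LHS](_ : _ = ev_dual K << k >> p - ev_dual K << 0 >> p) //.
  by rewrite !ev_dualU rmorph0 horner_sub_horner0.
Qed.

Lemma dense_ev_unit (L : idomainType) (S : pred L) (K : subComNzRingType S) :
  dense (range (ev K)) -> forall k : K, k != 0 -> val k \is a GRing.unit.
Proof.
move=> K_dense k k0; pose g : Map K L := fun j => (j == k)%:R.
have fX : finite_set [set 0; k] by rewrite finite_setU; split; exact: finite_set1.
pose N := [set h : Map K L | vanishing_on [set 0; k] (h - g)].
have gN : nbhs g N by rewrite nbhs_MapE; exists [set 0; k].
have [h [/interior_subset pg [p _ pE]]] := K_dense _ (ex_intro _ g gN) (open_interior N).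
have pgE j : [set 0; k] j -> p.[val j] = (j == k)%:R.
  move=> /pg pj; apply/eqP; rewrite -subr_eq0; apply/eqP.
  by rewrite -[RHS]pj -pE.
apply/unitrPr; exists (drop_poly 1 p).[val k].
rewrite -horner_sub_horner0 -(rmorph0 (val : K -> L)) !pgE; [|by left|by right].
by rewrite eqxx eq_sym (negPf k0) subr0.
Qed.

(** * The equivalence *)

Theorem theorem4p1 (L : idomainType) (S : pred L) (K : subComNzRingType S)
    (K_infinite : infinite_set [set: K]) :
  [<-> num_functionals K = range (freeg_frac K);
       asymptotically_split (ev_dual K);
       dense (range (ev K));
       Khat K `<=` range (@tofrac L);
       forall k : K, k != 0 -> val k \is a GRing.unit].
Proof.
tfae.
- by move/num_functionals_unit/asymptotically_split_ev_dual.
- by move/asymptotically_split_unit/dense_ev.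
- move/dense_ev_unit => Kunit _ [a [b [b0 ->]]].
  exists (val a / val b) => //; have ub := Kunit _ b0.
  by rewrite rmorphM /= rmorphV.
- move=> KhatL k k0; have vk0 : tofrac (val k) != 0.
    by rewrite tofrac_eq0 raddf_eq0 //; exact: val_inj.
  have [|x _ xE] := KhatL (tofrac (val (1 : K)) / tofrac (val k)).
    by exists 1, k.
  apply/unitrPr; exists x; apply/eqP; rewrite -tofrac_eq rmorphM /= xE.
  by rewrite !rmorph1 mul1r divff.
- exact: num_functionals_trivial.
Qed.
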